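(* Let $v$ and $w$ be $H_0$-radially symmetric $C^2_{H_0}$-smooth functions in $\mathbf{R}^N$. Then: (a) $(\Delta_H v)(x)=(\Delta v^* )(y)$ for all $x,y\in\mathbf{R}^N$ with $|y|=H_0(x)$, where $\Delta$ is the usual Laplacian; (b) $\Delta_H(\alpha v+\beta w)=\alpha\,\Delta_H v+\beta\,\Delta_H w$ in $\mathbf{R}^N$ for all $\alpha,\beta\in\mathbf{R}$.
   Context: Let $N\ge 1$ and let $H\in C(\mathbf{R}^N)\cap C^1(\mathbf{R}^N\setminus\{0\})$ be a norm of $\mathbf{R}^N$: $H\ge 0$, $H(\xi)=0$ iff $\xi=0$, $H$ is convex, and $H(\alpha\xi)=|\alpha|H(\xi)$ for $\xi\in\mathbf{R}^N$, $\alpha\in\mathbf{R}$. The dual norm is $H_0(x):=\sup_{\xi\ne 0}\frac{x\cdot\xi}{H(\xi)}$. Assume that the unit ball $\{\xi: H(\xi)<1\}$ is strictly convex (equivalently, $H_0\in C^1(\mathbf{R}^N\setminus\{0\})$). The Finsler-Laplace operator is $\Delta_H u:=\mathrm{div}\,(H(\nabla u)\nabla_\xi H(\nabla u))$, where $H(\xi)\nabla_\xi H(\xi)$ is taken to be $0$ at $\xi=0$. A function $v$ in $\mathbf{R}^N$ is $H_0$-radially symmetric if there is a function $v^\sharp$ on $[0,\infty)$ with $v(x)=v^\sharp(H_0(x))$ for all $x\in\mathbf{R}^N$. For such $v$ set $v^*(x):=v^\sharp(|x|)$ for $x\in\mathbf{R}^N$, where $|\cdot|$ is the Euclidean norm.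 An $H_0$-radially symmetric function $v$ is $C^2_{H_0}$-smooth if $v^*\in C^2(\mathbf{R}^N)$. *)

(* Defs.v *)
From HB Require Import structures.
From mathcomp Require Import all_boot all_order all_algebra.
From mathcomp Require Import all_classical all_reals all_analysis.

Set Implicit Arguments.
Unset Strict Implicit.
Unset Printing Implicit Defensive.

Import Order.TTheory GRing.Theory Num.Theory.
Import numFieldNormedType.Exports.

Local Open Scope classical_set_scope.
Local Open Scope ring_scope.

Section Euclidean.
Context {R : realType} {n : nat}.
Implicit Types (x y : 'rV[R]_n) (f : 'rV[R]_n -> R).

Definition dot x y : R := \sum_(i < n) x 0 i * y 0 i.

(* The library norm `|x| on 'rV[R]_n is the sup norm; it only supplies the
   topology and the notion of differentiability. *)
Definition enorm x : R := Num.sqrt (dot x x).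

Definition partial (i : 'I_n) f x : R := 'D_(delta_mx 0 i : 'rV[R]_n) f x.

Definition grad f x : 'rV[R]_n := \row_(i < n) partial i f x.

Definition div (F : 'rV[R]_n -> 'rV[R]_n) x : R :=
  \sum_(i < n) partial i (fun y => F y 0 i) x.

Definition laplacian f x : R := \sum_(i < n) partial i (partial i f) x.

(* Meant for open A. *)
Definition C1_on (A : set 'rV[R]_n) f : Prop :=
  forall x, A x ->
    differentiable f x /\ forall i, {for x, continuous (partial i f)}.

Definition C2 f : Prop := C1_on setT f /\ forall i, C1_on setT (partial i f).

Definition strictly_convex_set (A : set 'rV[R]_n) : Prop :=
  forall x y, closure A x -> closure A y -> x != y ->
    forall t : R, 0 < t -> t < 1 -> interior A (t *: x + (1 - t) *: y).

End Euclidean.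

Section Finsler.
Context {R : realType} {n : nat}.
Implicit Types (H v : 'rV[R]_n -> R) (vs : R -> R).

Record finsler_norm H : Prop := FinslerNorm {
  fnorm_continuous : continuous H;
  fnorm_C1 : C1_on [set xi | xi != 0] H;
  fnorm_ge0 : forall xi, 0 <= H xi;
  fnorm_eq0 : forall xi, H xi = 0 <-> xi = 0;
  fnorm_convex : convex_function setT H;
  fnormZ : forall (a : R) xi, H (a *: xi) = `|a| * H xi }.

Definition dual_norm H (x : 'rV[R]_n) : R :=
  sup [set dot x xi / H xi | xi in [set xi | xi != 0]].

Definition finsler_flux H v (x : 'rV[R]_n) : 'rV[R]_n :=
  let p := grad v x in if p == 0 then 0 else H p *: grad H p.

Definition finsler_laplacian H v : 'rV[R]_n -> R := div (finsler_flux H v).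

(* Derivatives are total functions, with arbitrary values where the limit does
   not exist; this says that those used in finsler_laplacian H v exist at every
   point. *)
Definition finsler_laplacian_exists H v : Prop :=
  (forall x, differentiable v x) /\
  (forall x, differentiable (finsler_flux H v) x).

(* vs stands for a function on [0, +oo[: its values at negative arguments are
   never used, as dual_norm H and enorm are nonnegative. *)
Definition radial_profile H v vs : Prop := forall x, v x = vs (dual_norm H x).

Definition euclidean_radial vs (x : 'rV[R]_n) : R := vs (enorm x).

Definition C2_radial H v : Prop :=
  exists2 vs, radial_profile H v vs & C2 (euclidean_radial vs).

End Finsler.

(* Main.v *)
(* Strict convexity makes the maximiser xi(x) of x . xi over {H = 1} unique for
   x <> 0, hence, by compactness, continuous in x; the subgradient inequality
   for H_0 at x and at x + h then gives grad H_0(x) = xi(x). As xi(x) also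
   minimises H_0(x) H(eta) - x . eta, one gets grad H(xi(x)) = x / H_0(x). So if
   v = h(H_0), the flux H(grad v) grad H(grad v) is (h'(H_0)/H_0) x, whose
   divergence h'' + (N-1) h'/H_0 only uses Euler's identity
   x . grad H_0(x) = H_0(x). The gradient of h(|y|) is (h'(|y|)/|y|) y, so the
   Euclidean Laplacian is the same expression at |y|, and it is linear in h. *)
Require Import Defs.
From HB Require Import structures.
From mathcomp Require Import all_boot all_order all_algebra.
From mathcomp Require Import all_classical all_reals all_analysis.
From mathcomp Require Import ring lra.
Import Order.TTheory GRing.Theory Num.Theory.
Import numFieldNormedType.Exports.
Local Open Scope classical_set_scope.
Local Open Scope ring_scope.

(** * Euclidean pairing and gradients as total derivatives *)

Section Dot.
Context {R : realType} {n : nat}.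
Implicit Types (x y a b : 'rV[R]_n) (f : 'rV[R]_n -> R).

Lemma dotC x y : dot x y = dot y x.
Proof. by apply: eq_bigr => i _; rewrite mulrC. Qed.

Definition dotr a x : R := dot x a.

Lemma dotr_is_linear a : linear (dotr a).
Proof.
move=> k x y; rewrite -[RHS]/(k * _ + _) /dotr /dot mulr_sumr -big_split.
by apply: eq_bigr => i _ /=; rewrite !mxE mulrDl mulrA.
Qed.

HB.instance Definition _ a :=
  GRing.isLinear.Build R 'rV[R]_n R _ (dotr a) (dotr_is_linear a).

Lemma dotDl x y a : dot (x + y) a = dot x a + dot y a.
Proof. exact: (linearD (dotr a)). Qed.

Lemma dotBl x y a : dot (x - y) a = dot x a - dot y a.
Proof. exact: (linearB (dotr a)). Qed.

Lemma dotZl (k : R) x a : dot (k *: x) a = k * dot x a.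
Proof. by rewrite -[LHS]/(dotr a _) linearZ. Qed.

Lemma dot0l a : dot 0 a = 0.
Proof. exact: (linear0 (dotr a)). Qed.

Lemma dotDr x y a : dot a (x + y) = dot a x + dot a y.
Proof. by rewrite dotC dotDl !(dotC a). Qed.

Lemma dotBr x y a : dot a (x - y) = dot a x - dot a y.
Proof. by rewrite dotC dotBl !(dotC a). Qed.

Lemma dotZr (k : R) x a : dot a (k *: x) = k * dot a x.
Proof. by rewrite dotC dotZl (dotC a). Qed.

Lemma dot0r a : dot a 0 = 0.
Proof. by rewrite dotC dot0l. Qed.

Lemma dot_delta (i : 'I_n) a : dot (delta_mx 0 i) a = a 0 i.
Proof.
rewrite /dot (bigD1 i)//= mxE !eqxx mul1r big1 ?addr0// => j ji.
by rewrite mxE eqxx (negbTE ji) mul0r.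
Qed.

Lemma coord_le_norm x (i : 'I_n) : `|x 0 i| <= `|x|.
Proof.
rewrite [leRHS]/Num.norm /= mx_normrE; apply/bigmax_geP; right => /=.
by exists (0, i).
Qed.

Lemma dot_le x a : `|dot x a| <= n%:R * `|x| * `|a|.
Proof.
apply: le_trans (ler_norm_sum _ _ _) _.
have -> : n%:R * `|x| * `|a| = \sum_(i < n) `|x| * `|a|.
  by rewrite sumr_const card_ord -mulrA mulr_natl.
by apply: ler_sum => i _; rewrite normrM ler_pM ?coord_le_norm.
Qed.

Lemma dotr_continuous a : continuous (dotr a).
Proof.
apply: bounded_linear_continuous; apply/linear_boundedP.
near=> r => x; apply: le_trans (dot_le x a) _.
rewrite mulrAC ler_wpM2r//; near: r; apply: nbhs_pinfty_ge.
Unshelve. all: by end_near. Qed.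

Lemma dot_self_gt0 x : x != 0 -> 0 < dot x x.
Proof.
move=> x0; rewrite lt_neqAle sumr_ge0 ?andbT; last by move=> i _; exact: sqr_ge0.
apply: contra x0; rewrite eq_sym psumr_eq0; last by move=> i _; exact: sqr_ge0.
move=> /allP x0; apply/eqP/rowP => i; rewrite mxE; apply/eqP.
by have := x0 i (mem_index_enum i); rewrite /= mulf_eq0 orbb.
Qed.

(** [grad] is a row of partial derivatives that may be junk; this predicate records both
    differentiability at [x] and the vector representing the differential. *)
Definition has_grad f x a := is_diff x f (dotr a).

Lemma has_gradP f x a :
  (forall e : R, 0 < e ->
     \forall h \near (0 : 'rV[R]_n), `|f (x + h) - f x - dot h a| <= e * `|h|) ->
  has_grad f x a.
Proof.
move=> fxa.
have E h : (f \o shift x - (cst (f x) + dotr a)) h = f (x + h) - f x - dot h a.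
  by rewrite [x + h]addrC -addrA -opprD.
have fxa' (e : R) : 0 < e -> \forall h \near (0 : 'rV[R]_n),
    `|(f \o shift x - (cst (f x) + dotr a)) h| <= e * `|h|.
  by move=> e0; apply: filterS (fxa e e0) => h; rewrite E.
have D : 'd f x = dotr a :> ('rV[R]_n -> R).
  by apply: diff_unique; [exact: dotr_continuous|apply/eqaddoP].
apply: DiffDef => //; apply/diff_locallyP; rewrite D; split.
  exact: dotr_continuous.
exact/eqaddoP.
Qed.

Lemma has_grad_near f x a : has_grad f x a -> forall e : R, 0 < e ->
  \forall h \near (0 : 'rV[R]_n), `|f (x + h) - f x - dot h a| <= e * `|h|.
Proof.
move=> [/diff_locally + D] e e0; rewrite D => /eqaddoP /(_ e e0).
apply: filterS => h /=; congr (`| _ | <= _).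
by rewrite [x + h]addrC -addrA -opprD.
Qed.

Lemma has_gradE f x a (i : 'I_n) : has_grad f x a -> partial i f x = a 0 i.
Proof. by move=> [fx D]; rewrite /partial deriveE// D /dotr dot_delta. Qed.

Lemma grad_has_grad f x a : has_grad f x a -> grad f x = a.
Proof. by move=> fxa; apply/rowP => i; rewrite mxE (has_gradE _ _ _ _ fxa). Qed.

Lemma differentiable_has_grad f x : differentiable f x -> has_grad f x (grad f x).
Proof.
move=> fx; apply: DiffDef => //; apply/funext => y.
rewrite {1}[y]row_sum_delta linear_sum; apply: eq_bigr => i _.
by rewrite linearZ mxE /partial deriveE.
Qed.

(** A small step from [x] along [- a] would lower [f] to first order by a multiple of [dot a a],
    more than the error term can make up for. *)
Lemma has_grad_min f x a : has_grad f x a -> (forall y, f x <= f y) -> a = 0.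
Proof.
move=> fxa fmin; apply/eqP; apply: contraT => a0.
have aa := dot_self_gt0 _ a0.
have na : 0 < `|a| by rewrite normr_gt0.
(* With this tolerance, the error of the step [- t *: a] is at most half of the first-order decrease
   [t * dot a a]. *)
have e0 : 0 < dot a a / `|a| / 2 by rewrite !divr_gt0.
have [/= d d0 D] := nbhs_norm0P.1 (has_grad_near _ _ _ fxa _ e0).
pose t := d / `|a| / 2.
have t0 : 0 < t by rewrite !divr_gt0.
have : `|- t *: a| < d.
  rewrite normrZ normrN gtr0_norm// /t mulrAC divfK ?gt_eqF//.
  by rewrite ltr_pdivrMr// ltr_pMr// ltr1n.
move=> /D /=; rewrite normrZ normrN (gtr0_norm t0).
rewrite dotZl mulNr opprK => H1.
have : t * dot a a <= dot a a / `|a| / 2 * (t * `|a|).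
  apply: le_trans H1; apply: le_trans (ler_norm _).
  by rewrite lerDr subr_ge0.
have -> : dot a a / `|a| / 2 * (t * `|a|) = t * dot a a / 2.
  by field; rewrite gt_eqF.
by have := mulr_gt0 t0 aa; lra.
Qed.

End Dot.

(** * Calculus rules for gradients *)

Section HasGrad.
Context {R : realType} {n : nat}.
Implicit Types (x a b : 'rV[R]_n) (f g : 'rV[R]_n -> R).

Lemma has_gradB f g x a b :
  has_grad f x a -> has_grad g x b -> has_grad (fun y => f y - g y) x (a - b).
Proof.
move=> fa gb; apply: (is_diff_eq (is_diffB fa gb)).
by apply/funext => y; rewrite /dotr dotBr.
Qed.

Lemma has_gradZ (k : R) f x a :
  has_grad f x a -> has_grad (fun y => k * f y) x (k *: a).
Proof.
move=> fa; apply: (is_diff_eq (is_diffZ k fa)).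
by apply/funext => y; rewrite /dotr dotZr.
Qed.

Lemma has_gradM f g x a b : has_grad f x a -> has_grad g x b ->
  has_grad (fun y => f y * g y) x (f x *: b + g x *: a).
Proof.
move=> fa gb; apply: (is_diff_eq (is_diffM fa gb)).
by apply/funext => y; rewrite /dotr dotDr !dotZr.
Qed.

Lemma has_grad_comp (h : R -> R) f x a (d : R) :
  is_derive (f x) 1 h d -> has_grad f x a -> has_grad (h \o f) x (d *: a).
Proof.
move=> [hd hE] fa.
have hdiff : is_diff (f x) h ( *:%R^~ d : R -> R).
  by apply: DiffDef; [exact/derivable1_diffP|rewrite deriv1E// derive1E hE].
apply: (is_diff_eq (is_diff_comp fa hdiff)).
by apply/funext => y; rewrite /= /dotr dotZr mulrC.
Qed.

Lemma has_grad_dotr a x : has_grad (dotr a) x a.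
Proof.
apply: DiffDef; first exact/linear_differentiable/dotr_continuous.
exact/diff_lin/dotr_continuous.
Qed.

End HasGrad.

(** * The dual norm and its maximisers *)

Section DualNorm.
Context {R : realType} {n : nat}.
Context (H : 'rV[R]_n -> R) (hH : finsler_norm H).
Implicit Types (x y xi eta zeta : 'rV[R]_n).

Lemma fnorm0 : H 0 = 0.
Proof. exact/(fnorm_eq0 hH). Qed.

Lemma fnorm_gt0 xi : xi != 0 -> 0 < H xi.
Proof.
move=> x0; rewrite lt_neqAle (fnorm_ge0 hH) andbT eq_sym.
by apply: contra x0 => /eqP/(fnorm_eq0 hH)/eqP.
Qed.

(** [H] attains a positive minimum on the compact unit sphere of the sup norm; by homogeneity [c]
    can be its inverse. *)
Lemma fnorm_norm_le : exists2 c : R, 0 < c & forall xi, `|xi| <= c * H xi.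
Proof.
pose S := [set xi : 'rV[R]_n | `|xi| = 1].
have cS : compact S.
  apply: bounded_closed_compact.
    by exists 1; split=> // r r1 x; rewrite /S/= => ->; exact: ltW.
  have /continuous_closedP/(_ _ (@closed_eq R 1)) := @norm_continuous R 'rV[R]_n.
  exact.
(* If the sphere is empty, every vector is 0 and [c = 1] will do. *)
have [S0|] := pselect (S !=set0); last first.
  move=> /set0P/negP; rewrite negbK => /eqP S0.
  exists 1 => // xi; have [->|xi0] := eqVneq xi 0.
    by rewrite fnorm0 normr0 mulr0.
  suff : S (`|xi|^-1 *: xi) by rewrite S0.
  by rewrite /S /= normrZ normfV normr_id mulVf// normr_eq0.
have [xi0 /set_mem S1 Hmin] : exists2 c, c \in S & forall t, t \in S -> H c <= H t.
  by apply: EVT_min_rV => //; apply: continuous_subspaceT; exact: fnorm_continuous hH.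
have Hxi0 : 0 < H xi0.
  apply: fnorm_gt0; apply: contraPneq S1 => ->.
  by rewrite /S/= normr0 => /esym/eqP; rewrite oner_eq0.
exists (H xi0)^-1; first by rewrite invr_gt0.
move=> xi; have [->|x0] := eqVneq xi 0; first by rewrite fnorm0 normr0 mulr0.
have nx : 0 < `|xi| by rewrite normr_gt0.
rewrite ler_pdivlMl//.
have : H xi0 <= H (`|xi|^-1 *: xi).
  by apply: Hmin; rewrite inE /S /= normrZ normfV normr_id mulVf// gt_eqF.
by rewrite (fnormZ hH) normfV normr_id ler_pdivlMl// mulrC.
Qed.

Lemma compact_fsphere : compact [set xi | H xi = 1].
Proof.
have [c c0 Hc] := fnorm_norm_le.
apply: bounded_closed_compact.
  exists c; split; first exact: num_real.
  by move=> r cr xi /= Hxi; apply: (le_trans (Hc xi)); rewrite Hxi mulr1 ltW.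
by have /continuous_closedP/(_ _ (@closed_eq R 1)) := fnorm_continuous hH.
Qed.

(** Maximality of [xi] on the unit sphere of [H], put in homogeneous form so that it can be tested
    on any vector. It reads x . eta <= H_0(x) H(eta) once [dot x xi] is known to be the dual
    norm. *)
Definition dual_at x xi := H xi = 1 /\ forall eta, dot x eta <= dot x xi * H eta.

Lemma dual_at_neq0 x xi : dual_at x xi -> xi != 0.
Proof.
move=> [Hxi _]; apply: contra_eq_neq Hxi => ->.
by rewrite fnorm0 eq_sym oner_neq0.
Qed.

Lemma dual_at_sphere x xi eta : dual_at x xi -> H eta = 1 -> dot x eta <= dot x xi.
Proof. by move=> [_ /(_ eta)] + Heta; rewrite Heta mulr1. Qed.

Lemma dual_at_gt0 x xi : dual_at x xi -> x != 0 -> 0 < dot x xi.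
Proof.
move=> [_ /(_ x) xx] x0.
by rewrite -(pmulr_lgt0 _ (fnorm_gt0 _ x0)) (lt_le_trans _ xx)// dot_self_gt0.
Qed.

Lemma fsphere_proj xi : xi != 0 -> H ((H xi)^-1 *: xi) = 1.
Proof.
move=> /fnorm_gt0 Hxi.
by rewrite (fnormZ hH) ger0_norm ?invr_ge0 ?ltW// mulVf// gt_eqF.
Qed.

Lemma dual_at_max x xi :
  H xi = 1 -> (forall eta, H eta = 1 -> dot x eta <= dot x xi) -> dual_at x xi.
Proof.
move=> Hxi xmax; split=> // eta.
have [->|eta0] := eqVneq eta 0; first by rewrite fnorm0 mulr0 dot0r.
have := xmax _ (fsphere_proj _ eta0).
by rewrite dotZr ler_pdivrMl ?fnorm_gt0// mulrC.
Qed.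

Lemma ex_dual_at x : x != 0 -> exists xi, dual_at x xi.
Proof.
move=> x0.
have [||xi /set_mem Hxi ximax] := EVT_max_rV (A := [set xi | H xi = 1])
    (f := dotr x) _ compact_fsphere.
- by exists ((H x)^-1 *: x); exact: fsphere_proj.
- exact/continuous_subspaceT/dotr_continuous.
exists xi; apply: dual_at_max => // eta Heta.
by rewrite dotC (dotC x); apply: ximax; rewrite inE.
Qed.

Lemma dual_normE x xi : dual_at x xi -> dual_norm H x = dot x xi.
Proof.
move=> xxi; have [Hxi xmax] := xxi.
have mem : [set dot x xi / H xi | xi in [set xi | xi != 0]] (dot x xi).
  by exists xi; [exact: dual_at_neq0 xxi|rewrite Hxi divr1].
have ub : ubound [set dot x xi / H xi | xi in [set xi | xi != 0]] (dot x xi).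
  by move=> _ [eta eta0 <-]; rewrite ler_pdivrMr ?fnorm_gt0.
apply/eqP; rewrite eq_le; apply/andP; split.
  by apply: ge_sup => //; exists (dot x xi).
by apply: ub_le_sup => //; exists (dot x xi).
Qed.

Lemma dual_norm0 : dual_norm H 0 = 0.
Proof.
apply/eqP; rewrite eq_le; apply/andP.
rewrite /dual_norm; set S := (X in sup X).
have S0 r : S r -> r = 0 by move=> [eta _ <-]; rewrite dot0l mul0r.
(* In dimension 0 there is no nonzero vector, and the supremum of the empty set is 0 by
   convention. *)
have [[r Sr]|/set0P/negP] := pselect (S !=set0); last first.
  by rewrite negbK => /eqP ->; rewrite sup0.
suff -> : S = [set 0] by rewrite sup1.
by apply/seteqP; split=> [t /S0 //|_ ->]; rewrite -(S0 _ Sr).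
Qed.

Lemma dual_norm_gt0 x : x != 0 -> 0 < dual_norm H x.
Proof.
move=> x0; have [xi xxi] := ex_dual_at _ x0.
by rewrite (dual_normE _ _ xxi) dual_at_gt0.
Qed.

Lemma dual_norm_ge0 x : 0 <= dual_norm H x.
Proof.
by have [->|/dual_norm_gt0/ltW//] := eqVneq x 0; rewrite dual_norm0.
Qed.

Lemma dual_normZ (t : R) x : 0 < t -> dual_norm H (t *: x) = t * dual_norm H x.
Proof.
move=> t0; have [->|x0] := eqVneq x 0; first by rewrite scaler0 dual_norm0 mulr0.
have [xi xxi] := ex_dual_at _ x0.
rewrite (dual_normE _ _ xxi) (dual_normE _ xi) ?dotZl//.
by split=> [|eta]; [exact: xxi.1|rewrite !dotZl -mulrA ler_pM2l// xxi.2].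
Qed.

(** Ensures that a radial function determines its profile on the whole half-line. *)
Lemma dual_norm_surj x0 (r : R) : x0 != 0 -> 0 <= r -> exists x, dual_norm H x = r.
Proof.
move=> /dual_norm_gt0 px0; rewrite le_eqVlt => /predU1P[<-|r0].
  by exists 0; exact: dual_norm0.
exists ((r / dual_norm H x0) *: x0).
by rewrite dual_normZ ?divr_gt0// divfK// gt_eqF.
Qed.

Lemma dual_norm_le : exists2 c : R, 0 < c & forall x, dual_norm H x <= c * `|x|.
Proof.
have [c c0 Hc] := fnorm_norm_le.
exists ((n%:R + 1) * c); first by rewrite mulr_gt0// ltr_wpDl.
move=> x; have [->|x0] := eqVneq x 0; first by rewrite dual_norm0 normr0 mulr0.
have [xi xxi] := ex_dual_at _ x0; rewrite (dual_normE _ _ xxi).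
apply: le_trans (ler_norm _) _; apply: le_trans (dot_le _ _) _.
have := Hc xi; rewrite xxi.1 mulr1 => xic.
rewrite (mulrAC _ c) ler_pM ?mulr_ge0//.
by rewrite ler_wpM2r// lerDl.
Qed.

(** Strict convexity speaks of the closure of the open ball; a unit vector is reached there by
    shrinking it slightly. *)
Lemma fball_closure xi : H xi = 1 -> closure [set eta | H eta < 1] xi.
Proof.
move=> Hxi B /nbhs_normP[/= e e0 eB].
have nx : 0 < `|xi|.
  rewrite normr_gt0; apply: contra_eq_neq Hxi => ->.
  by rewrite fnorm0 eq_sym oner_neq0.
(* Chosen so that both [s < 1] and s |xi| < e. *)
pose s := e / (e + `|xi|).
have es : 0 < e + `|xi| by rewrite addr_gt0.
have s0 : 0 < s by rewrite divr_gt0.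
have s1 : s < 1 by rewrite ltr_pdivrMr// mul1r ltrDl.
exists ((1 - s) *: xi); split.
  by rewrite /= (fnormZ hH) Hxi mulr1 gtr0_norm; lra.
apply: eB; rewrite /ball_ /= scalerBl scale1r opprB addrC subrK normrZ gtr0_norm//.
by rewrite /s mulrAC ltr_pdivrMr// ltr_pM2l// ltrDr.
Qed.

(** * Strict convexity: unique, continuous maximisers and the gradient of the dual norm *)

Context (hball : strictly_convex_set [set xi | H xi < 1]).

(** The midpoint of two distinct maximisers would have the same positive pairing with [x] but [H]
    less than 1, against maximality. *)
Lemma dual_at_uniq x xi eta : x != 0 -> dual_at x xi -> dual_at x eta -> xi = eta.
Proof.
move=> x0 xxi xeta; apply/eqP; apply: contraT => xieta.
have E : dot x eta = dot x xi.
  apply/eqP; rewrite eq_le (dual_at_sphere _ _ _ xxi xeta.1).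
  by rewrite (dual_at_sphere _ _ _ xeta xxi.1).
have /interior_subset/= :
    ([set xi | H xi < 1]^°)%classic (2^-1 *: xi + (1 - 2^-1) *: eta).
  apply: hball => //; rewrite ?invr_gt0// ?invf_lt1// ?ltr1n//.
  - exact: fball_closure xxi.1.
  - exact: fball_closure xeta.1.
set m := _ + _ => Hm.
have := xxi.2 m; rewrite /m dotDr !dotZr E -/m.
have -> : 2^-1 * dot x xi + (1 - 2^-1) * dot x xi = dot x xi by lra.
by rewrite -ler_pdivrMl ?dual_at_gt0// mulVf ?gt_eqF ?dual_at_gt0// leNgt Hm.
Qed.

(** Continuity of the maximiser. On the compact set of unit vectors at distance at least [e] from
    [xi], the maximum of the pairing with [x] stays strictly below [dot x xi] by uniqueness; a small
    change of [x] cannot close this gap. *)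
Lemma dual_at_stable x xi (e : R) : x != 0 -> dual_at x xi -> 0 < e ->
  exists2 d : R, 0 < d &
    forall y zeta, `|y - x| < d -> dual_at y zeta -> `|zeta - xi| < e.
Proof.
move=> x0 xxi e0.
pose K := [set zeta | H zeta = 1] `&` [set zeta | e <= `|zeta - xi|].
have cK : compact K.
  apply: compact_closedI; first exact: compact_fsphere.
  have : continuous (fun zeta => `|zeta - xi|).
    move=> z; apply: continuous_comp; last exact: norm_continuous.
    by apply: continuousB; [exact: cvg_id|exact: cst_continuous].
  by move=> /continuous_closedP/(_ _ (@closed_ge R e)).
have [K0|/set0P/negP] := pselect (K !=set0); last first.
  rewrite negbK => /eqP K0; exists 1 => // y zeta _ yzeta.
  rewrite ltNge; apply/negP => ez.
  suff : K zeta by rewrite K0.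
  by split=> //; exact: yzeta.1.
have [|z0 /set_mem[Hz0 ez0] z0max] := EVT_max_rV (f := dotr x) K0 cK.
  exact/continuous_subspaceT/dotr_continuous.
have gap : dot x z0 < dot x xi.
  rewrite lt_neqAle (dual_at_sphere _ _ _ xxi Hz0) andbT.
  apply: contraTneq ez0 => E; rewrite -ltNge.
  suff <- : xi = z0 by rewrite subrr normr0.
  apply: (dual_at_uniq x) => //; apply: dual_at_max => // eta Heta.
  by rewrite E; exact: dual_at_sphere xxi Heta.
have [c c0 Hc] := fnorm_norm_le.
have N1 : 0 < (n%:R + 1) * (2 * c) :> R by rewrite !mulr_gt0// ltr_wpDl.
(* Two unit vectors of [H] are at most [2 * c] apart and [dot_le] costs a factor n; n + 1 keeps the
   denominator positive. *)
exists ((dot x xi - dot x z0) / ((n%:R + 1) * (2 * c))).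
  by rewrite divr_gt0// subr_gt0.
move=> y zeta; rewrite ltr_pdivlMr// => yx yzeta; rewrite ltNge; apply/negP => ez.
have H1 : dot x zeta <= dot x z0.
  by rewrite dotC (dotC x); apply: z0max; rewrite inE; split=> //; exact: yzeta.1.
have H2 := dual_at_sphere _ _ _ yzeta xxi.1.
(* [H1] and [H2] bound the same pairing from below by the gap. *)
have H3 : dot (y - x) (zeta - xi) < dot x xi - dot x z0.
  apply: le_lt_trans yx; apply: le_trans (ler_norm _) _.
  apply: le_trans (dot_le _ _) _; rewrite -mulrA mulrCA ler_wpM2l//.
  rewrite ler_pM//; first by rewrite lerDl.
  apply: le_trans (ler_normB _ _) _.
  have := Hc zeta; have := Hc xi; rewrite xxi.1 yzeta.1; lra.
by move: H3; rewrite dotBl !dotBr; lra.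
Qed.

(** If [zeta] is the maximiser at [x + h], comparing [xi] and [zeta] at both points puts the
    remainder between 0 and [dot h (zeta - xi)], and [zeta] tends to [xi]. *)
Lemma has_grad_dual_norm x xi : x != 0 -> dual_at x xi -> has_grad (dual_norm H) x xi.
Proof.
move=> x0 xxi; apply: has_gradP => e e0.
have n1 : 0 < n%:R + 1 :> R by rewrite ltr_wpDl.
have [|d d0 xd] := dual_at_stable x xi (e / (n%:R + 1)) x0 xxi; first exact: divr_gt0.
have nx : 0 < `|x| by rewrite normr_gt0.
(* The bound by |x| keeps [x + h] away from 0. *)
apply/nbhs_norm0P; exists (Num.min d `|x|); first by rewrite /= lt_min d0.
move=> h /=; rewrite lt_min => /andP[hd hx].
have xh0 : x + h != 0.
  by rewrite addrC addr_eq0; apply: contraTneq hx => ->; rewrite normrN ltxx.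
have [zeta hzeta] := ex_dual_at _ xh0.
rewrite (dual_normE _ _ xxi) (dual_normE _ _ hzeta).
have H1 := dual_at_sphere _ _ _ hzeta xxi.1.
have H2 := dual_at_sphere _ _ _ xxi hzeta.1.
have H3 : dot h (zeta - xi) <= e * `|h|.
  apply: le_trans (ler_norm _) _; apply: le_trans (dot_le _ _) _.
  rewrite mulrAC ler_wpM2r//.
  have : `|zeta - xi| < e / (n%:R + 1).
    by apply: (xd (x + h) zeta _ hzeta); rewrite [x + h]addrC addrK.
  rewrite ltr_pdivlMr// => H4.
  by apply: le_trans (ltW H4); rewrite mulrC ler_wpM2l// lerDl.
move: H1 H3; rewrite dotBr !dotDl => H1 H3.
by rewrite ger0_norm; lra.
Qed.

Lemma dual_at_ge (s : R) x xi eta : dual_at x xi ->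
  Num.sg s * dot x eta <= dot x xi * H eta.
Proof.
move=> xxi; have := xxi.2 (Num.sg s *: eta).
rewrite (fnormZ hH) dotZr => /le_trans; apply.
rewrite mulrCA ler_piMl ?normr_sg ?lern1//.
  rewrite mulr_ge0 ?(fnorm_ge0 hH)//.
  (* Testing maximality on [- xi] gives [0 <= dot x xi]. *)
  by have := xxi.2 (-1 *: xi); rewrite (fnormZ hH) xxi.1 dotZr normrN normr1; lra.
by case: (s != 0).
Qed.

(** By [dual_at_ge], the function [dot x xi * H eta - Num.sg s * dot x eta] of [eta] is nonnegative
    and vanishes at [s *: xi], so its gradient is 0 there. The sign allows for decreasing profiles,
    where [s], the derivative of the profile, is negative. *)
Lemma grad_fnorm_dual_at (s : R) x xi : s != 0 -> x != 0 -> dual_at x xi ->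
  dot x xi *: grad H (s *: xi) = Num.sg s *: x.
Proof.
move=> s0 x0 xxi; have sxi0 : s *: xi != 0.
  by rewrite scaler_eq0 negb_or s0 (dual_at_neq0 _ _ xxi).
have [dH _] := fnorm_C1 hH sxi0.
have := has_gradB _ _ _ _ _
  (has_gradZ (dot x xi) _ _ _ (differentiable_has_grad _ _ dH))
  (has_gradZ (Num.sg s) _ _ _ (has_grad_dotr x (s *: xi))).
move=> /has_grad_min grad0; apply/eqP; rewrite -subr_eq0; apply/eqP/grad0 => eta.
have -> : Num.sg s * dotr x (s *: xi) = dot x xi * `|s|.
  by rewrite /dotr dotC dotZr mulrA -normrEsg mulrC.
by rewrite (fnormZ hH) xxi.1 mulr1 subrr subr_ge0 /dotr dotC dual_at_ge.
Qed.

End DualNorm.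

Lemma is_derive_near {R : realType} (h : R -> R) (t d e : R) :
  is_derive t 1 h d -> 0 < e ->
  \forall s \near (0 : R), `|h (t + s) - h t - s * d| <= e * `|s|.
Proof.
move=> [/derivable1_diffP hd hE] e0.
have := diff_locally hd; rewrite diff1E// derive1E hE => /eqaddoP /(_ e e0).
apply: filterS => s /=; congr (`| _ | <= _).
by rewrite [t + s]addrC -addrA -opprD.
Qed.

(** * Radial functions and fields over an abstract gauge *)

Section Radial.
Context {R : realType} {n : nat}.

(** What the Euclidean norm and the dual norm share, so that the divergence is computed once for
    both; [q] is the gradient away from 0 and [gauge_dot] is Euler's identity. *)
Record gauge (G : 'rV[R]_n -> R) (q : 'rV[R]_n -> 'rV[R]_n) : Prop := Gauge {
  gauge0 : G 0 = 0;
  gauge_gt0 : forall x, x != 0 -> 0 < G x;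
  gauge_le : exists2 c : R, 0 < c & forall x, G x <= c * `|x|;
  gauge_grad : forall x, x != 0 -> has_grad G x (q x);
  gauge_dot : forall x, x != 0 -> dot x (q x) = G x }.

(* [derive1 h 0 = 0] is all that is kept of evenness: it makes [h \o G] differentiable at 0. *)
Record flat_profile (h : R -> R) : Prop := FlatProfile {
  profile_derivable : forall t, derivable h t 1;
  profile_derivable2 : forall t, derivable (derive1 h) t 1;
  profile_derive0 : derive1 h 0 = 0 }.

(* At [x = 0] the junk quotient is harmless, being multiplied by [x]. *)
Definition radial_field (h : R -> R) (G : 'rV[R]_n -> R) (x : 'rV[R]_n) :=
  (derive1 h (G x) / G x) *: x.

(** The value at 0 comes from h'(r)/r -> h''(0), which holds because h'(0) = 0. *)
Definition radial_laplacian (h : R -> R) (r : R) : R :=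
  if r == 0 then n%:R * derive1 (derive1 h) 0
  else derive1 (derive1 h) r + (n%:R - 1) * (derive1 h r / r).

Context (G : 'rV[R]_n -> R) (q : 'rV[R]_n -> 'rV[R]_n) (gG : gauge G q).
Context (h : R -> R) (ph : flat_profile h).

Lemma gauge_ge0 x : 0 <= G x.
Proof.
by have [->|/(gauge_gt0 _ _ gG)/ltW//] := eqVneq x 0; rewrite (gauge0 _ _ gG).
Qed.

Lemma near_gauge0 (P : R -> Prop) :
  (\forall s \near (0 : R), P s) -> \forall x \near (0 : 'rV[R]_n), P (G x).
Proof.
have [c c0 Gc] := gauge_le _ _ gG.
move=> /nbhs_norm0P[/= d d0 dP]; apply/nbhs_norm0P; exists (d / c).
  exact: divr_gt0.
move=> x /=; rewrite ltr_pdivlMr// mulrC => xd.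
by apply: dP; rewrite /= ger0_norm ?gauge_ge0// (le_lt_trans (Gc x)).
Qed.

Lemma has_grad_radial x : has_grad (h \o G) x (derive1 h (G x) *: q x).
Proof.
have [->|x0] := eqVneq x 0; last first.
  apply: has_grad_comp; last exact: gauge_grad.
  by rewrite derive1E; exact/derivableP/profile_derivable.
rewrite (gauge0 _ _ gG) (profile_derive0 _ ph) scale0r.
have [c c0 Gc] := gauge_le _ _ gG.
apply: has_gradP => e e0.
have /is_derive_near : is_derive (0 : R) (1 : R) h 0.
  by have := derivableP (profile_derivable _ ph 0); rewrite -derive1E profile_derive0.
(* At 0 the derivative of [h] vanishes, so the increment is at most (e/c) G(y), hence at most e
   |y|. *)
move=> /(_ _ (divr_gt0 e0 c0))/near_gauge0; apply: filterS => y.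
rewrite !add0r mulr0 dot0r /= (gauge0 _ _ gG) => /le_trans; apply.
by rewrite mulrAC ler_pdivrMr// -mulrA ler_pM2l// ger0_norm ?gauge_ge0// mulrC.
Qed.

Lemma is_derive_quotient (r : R) : r != 0 ->
  is_derive r 1 (fun t => derive1 h t / t)
    ((derive1 (derive1 h) r - derive1 h r / r) / r).
Proof.
move=> r0.
have h2 : is_derive r 1 (derive1 h) (derive1 (derive1 h) r).
  by rewrite derive1E; exact/derivableP/profile_derivable2.
have iv : is_derive r 1 (fun t : R => t^-1) (- r ^- 2).
  split; first exact: derivableV.
  by rewrite deriveV// derive_id [LHS]mulr1.
apply: (is_derive_eq (is_deriveM h2 iv)).
rewrite /GRing.scale/=; field.
exact: r0.
Qed.

(** Away from 0 this is the product rule. At 0 the remainder is [y 0 i] times h'(G(y))/G(y) -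
    h''(0), and the second factor is small because h'(0) = 0. *)
Lemma has_grad_radial_field (i : 'I_n) x :
  has_grad (fun y => radial_field h G y 0 i) x
  (if x == 0 then derive1 (derive1 h) 0 *: delta_mx 0 i else
    (derive1 h (G x) / G x) *: delta_mx 0 i +
    x 0 i *: (((derive1 (derive1 h) (G x) - derive1 h (G x) / G x) / G x) *: q x)).
Proof.
have [->|x0] := eqVneq x 0; last first.
  have -> : (fun y => radial_field h G y 0 i) =
      (fun y => ((fun t => derive1 h t / t) \o G) y * dotr (delta_mx 0 i) y).
    by apply/funext => y; rewrite mxE /dotr dotC dot_delta.
  have -> : x 0 i = dotr (delta_mx 0 i) x by rewrite /dotr dotC dot_delta.
  apply: has_gradM; last exact: has_grad_dotr.
  apply: has_grad_comp; last exact: gauge_grad.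
  by apply: is_derive_quotient; rewrite gt_eqF// (gauge_gt0 _ _ gG).
apply: has_gradP => e e0.
have /is_derive_near : is_derive (0 : R) (1 : R) (derive1 h) (derive1 (derive1 h) 0).
  by rewrite derive1E; exact/derivableP/profile_derivable2.
move=> /(_ _ e0)/near_gauge0; apply: filterS => y.
have [->|y0] := eqVneq y 0.
  by move=> _; rewrite addr0 subrr dot0l subr0 !normr0 mulr0.
rewrite add0r (profile_derive0 _ ph) subr0 (ger0_norm (gauge_ge0 _)).
rewrite add0r dotZr dotC dot_delta /radial_field !mxE mulr0 subr0 -mulrBl normrM => H1.
rewrite ler_pM ?coord_le_norm//.
have Gy0 : 0 < G y by exact: (gauge_gt0 _ _ gG).
rewrite -(ler_pM2r Gy0) -[X in `|_| * X](ger0_norm (gauge_ge0 y)) -normrM.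
by rewrite mulrBl divfK ?gt_eqF// [_ * G y]mulrC.
Qed.

Lemma differentiable_radial_field x : differentiable (radial_field h G) x.
Proof.
have -> : radial_field h G =
    \sum_(i < n) (fun y => radial_field h G y 0 i *: (delta_mx 0 i : 'rV[R]_n)).
  apply/funext => y; rewrite fct_sumE.
  exact: row_sum_delta.
apply: differentiable_sum => i; apply: differentiableZl.
by have [] := has_grad_radial_field i x.
Qed.

(** Away from 0, Euler's identity turns the sum of the terms [x 0 i * q x 0 i] into [G x], leaving n
    h'/G + (h'' - h'/G). *)
Lemma div_radial_field x : div (radial_field h G) x = radial_laplacian h (G x).
Proof.
rewrite /div /radial_laplacian.
under eq_bigr => i _ do rewrite (has_gradE _ _ _ _ (has_grad_radial_field i x)).
have [->|x0] := eqVneq x 0.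
  rewrite (gauge0 _ _ gG) eqxx.
  under eq_bigr do rewrite !mxE !eqxx mulr1.
  by rewrite sumr_const card_ord mulr_natl.
have Gx0 : G x != 0 by rewrite gt_eqF// (gauge_gt0 _ _ gG).
rewrite (negbTE Gx0).
under eq_bigr => i _ do rewrite !mxE !eqxx mulr1 mulrCA.
rewrite big_split/= sumr_const card_ord -mulr_sumr.
rewrite -[\sum_(i < n) _]/(dot x (q x)) (gauge_dot _ _ gG)// divfK//.
by rewrite -mulr_natl; ring.
Qed.

End Radial.

(** * One-variable profiles and their regularity *)

Section Profile.
Context {R : realType}.

Lemma profile_lincomb (h1 h2 : R -> R) (a b : R) :
  flat_profile h1 -> flat_profile h2 ->
  flat_profile (fun t => a * h1 t + b * h2 t) /\
  forall n r, radial_laplacian (n := n) (fun t => a * h1 t + b * h2 t) r =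
    a * radial_laplacian (n := n) h1 r + b * radial_laplacian (n := n) h2 r.
Proof.
have comb (f g : R -> R) :
    (forall t, derivable f t 1) -> (forall t, derivable g t 1) ->
    (forall t, derivable (fun t => a * f t + b * g t) t 1) /\
    derive1 (fun t => a * f t + b * g t) = (fun t => a * derive1 f t + b * derive1 g t).
  move=> df dg.
  have D (t : R) : is_derive t 1 (fun t => a * f t + b * g t)
      (a * derive1 f t + b * derive1 g t).
    rewrite !derive1E.
    exact: (is_deriveD (is_deriveZ a (derivableP (df t)))
      (is_deriveZ b (derivableP (dg t)))).
  by split=> [t|]; [case: (D t)|apply/funext => t; rewrite derive1E; case: (D t)].
move=> p1 p2.
have [d1 E1] := comb _ _ (profile_derivable _ p1) (profile_derivable _ p2).
have [d2 E2] := comb _ _ (profile_derivable2 _ p1) (profile_derivable2 _ p2).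
split.
  split; [exact: d1|by rewrite E1; exact: d2|].
  by rewrite E1 (profile_derive0 _ p1) (profile_derive0 _ p2) !mulr0 addr0.
have lin1 (c x y : R) : c * (a * x + b * y) = a * (c * x) + b * (c * y).
  by ring.
have lin2 (x y c u1 u2 z : R) : a * x + b * y + c * ((a * u1 + b * u2) * z) =
    a * (x + c * (u1 * z)) + b * (y + c * (u2 * z)) by ring.
move=> n r; rewrite /radial_laplacian E1 E2.
by case: ifP => _; [exact: lin1|exact: lin2].
Qed.

Lemma is_derive_line {n} (f : 'rV[R]_n -> R) (i : 'I_n) (t : R) :
  differentiable f (t *: delta_mx 0 i) ->
  is_derive t 1 (fun s : R => f (s *: delta_mx 0 i))
    (partial i f (t *: delta_mx 0 i)).
Proof.
move=> /differentiable_has_grad fa.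
have D := is_diff_comp (is_diff_scalel t (delta_mx 0 i : 'rV[R]_n)) fa.
split; first by apply: diff_derivable; case: D.
rewrite deriveE; last by case: D.
by rewrite (@diff_val _ _ _ _ _ _ _ D) /= scale1r /dotr dot_delta mxE.
Qed.

Lemma enorm_ge0 {n} (x : 'rV[R]_n) : 0 <= enorm x.
Proof. exact: sqrtr_ge0. Qed.

Lemma enormZ {n} (t : R) (x : 'rV[R]_n) : enorm (t *: x) = `|t| * enorm x.
Proof. by rewrite /enorm dotZl dotZr mulrA -expr2 sqrtrM ?sqr_ge0// sqrtr_sqr. Qed.

Lemma enorm_delta {n} (i : 'I_n) : enorm (delta_mx 0 i : 'rV[R]_n) = 1.
Proof. by rewrite /enorm dot_delta mxE !eqxx sqrtr1. Qed.

(** [vs] is arbitrary on negative arguments, so it is replaced by its even extension vs(|t|). This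
    is the radial function restricted to a coordinate axis, from which it inherits two
    derivatives. *)
Lemma euclidean_radial_profile {n} (i : 'I_n) (vs : R -> R) :
  C2 (euclidean_radial vs : 'rV[R]_n -> R) ->
  exists h, [/\ flat_profile h & forall r, 0 <= r -> h r = vs r].
Proof.
move=> [C1v C1d]; set f := euclidean_radial vs in C1v C1d.
pose h t := f (t *: delta_mx 0 i).
have hE t : h t = vs `|t|.
  by rewrite /h /f /euclidean_radial enormZ enorm_delta mulr1.
have dh (t : R) : is_derive t 1 h (partial i f (t *: delta_mx 0 i)).
  by apply: is_derive_line; case: (C1v (t *: delta_mx 0 i) I).
have h1 : derive1 h = (fun t => partial i f (t *: delta_mx 0 i)).
  by apply/funext => t; rewrite derive1E; case: (dh t).
exists h; split; last by move=> r r0; rewrite hE ger0_norm.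
split.
- by move=> t; case: (dh t).
- move=> t; rewrite h1.
  have /is_derive_line[] // : differentiable (partial i f) (t *: delta_mx 0 i).
  by case: (C1d i (t *: delta_mx 0 i) I).
(* Evenness makes h'(0) its own opposite. *)
have : derive1 (h \o -%R) 0 = derive1 h 0.
  by congr (derive1 _ 0); apply/funext => t; rewrite /= !hE normrN.
rewrite derive1_comp; last 2 first.
- exact: derivable_opp.
- by case: (dh (- 0)).
have -> : derive1 -%R (0 : R) = -1 by rewrite derive1E derive_val.
rewrite oppr0; lra.
Qed.

(** * The Euclidean norm as a gauge, and the Euclidean Laplacian *)

Lemma gauge_enorm {n} : gauge (enorm : 'rV[R]_n -> R) (fun x => (enorm x)^-1 *: x).
Proof.
have en0 (x : 'rV[R]_n) : x != 0 -> 0 < enorm x.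
  by move=> x0; rewrite sqrtr_gt0 dot_self_gt0.
split=> //.
- by rewrite /enorm dot0l sqrtr0.
(* After squaring, x . x <= n |x|^2 <= (n + 1)^2 |x|^2 in the sup norm. *)
- exists (n%:R + 1) => [|x]; first by rewrite ltr_wpDl.
  rewrite -ler_sqr ?nnegrE ?enorm_ge0 ?mulr_ge0 ?addr_ge0//.
  rewrite sqr_sqrtr; last by apply: sumr_ge0 => i _; exact: sqr_ge0.
  apply: le_trans (ler_norm _) _; apply: le_trans (dot_le _ _) _.
  rewrite exprMn -mulrA -expr2 ler_wpM2r ?sqr_ge0//.
  have : 0 <= n%:R :> R by [].
  nra.
- move=> x x0.
  have D : has_grad (fun y => dot y y) x (2 *: x).
    apply: has_gradP => e e0.
    have n1 : 0 < n%:R + 1 :> R by rewrite ltr_wpDl.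
    apply/nbhs_norm0P; exists (e / (n%:R + 1)); first exact: divr_gt0.
    move=> y /=; rewrite ltr_pdivlMr// => ye.
    have -> : dot (x + y) (x + y) - dot x x - dot y (2 *: x) = dot y y.
      by rewrite dotDl !dotDr dotZr (dotC x y); ring.
    apply: le_trans (dot_le _ _) _; rewrite ler_wpM2r//.
    by apply: le_trans (ltW ye); rewrite mulrC ler_wpM2l// lerDl.
  have : has_grad (Num.sqrt \o (fun y => dot y y)) x ((2 * enorm x)^-1 *: (2 *: x)).
    by apply: has_grad_comp => //; apply: is_derive1_sqrt; exact: dot_self_gt0.
  by rewrite scalerA invfM mulrAC mulVf ?mul1r// pnatr_eq0.
- move=> x x0; rewrite dotZr -[dot x x]sqr_sqrtr ?expr2 ?ltW ?dot_self_gt0//.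
  by rewrite -/(enorm x) mulKf// gt_eqF// en0.
Qed.

(** For the Euclidean gauge, [q x] is x/|x|, so the gradient of [h \o enorm] is itself the radial
    field. *)
Lemma laplacian_radial {n} (h : R -> R) (y : 'rV[R]_n) : flat_profile h ->
  laplacian (h \o enorm) y = radial_laplacian (n := n) h (enorm y).
Proof.
move=> ph; rewrite -(div_radial_field _ _ gauge_enorm _ ph).
apply: eq_bigr => i _; congr (partial i _ y); apply/funext => x.
by rewrite (has_gradE _ _ _ _ (has_grad_radial _ _ gauge_enorm _ ph x)) !mxE mulrA.
Qed.

(** * The dual norm as a gauge, and the Finsler Laplacian *)

Lemma gauge_dual_norm {n} (H : 'rV[R]_n -> R) (hH : finsler_norm H)
    (hball : strictly_convex_set [set xi | H xi < 1]) :
  gauge (dual_norm H) (fun x => xget 0 (dual_at H x)).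
Proof.
have xgetP x : x != 0 -> dual_at H x (xget 0 (dual_at H x)).
  by move=> x0; exact: (xgetPex 0 (ex_dual_at _ hH _ x0)).
split.
- exact: dual_norm0.
- exact: dual_norm_gt0.
- exact: dual_norm_le.
- by move=> x x0; apply: has_grad_dual_norm => //; exact: xgetP.
- by move=> x x0; rewrite (dual_normE _ hH _ _ (xgetP _ x0)).
Qed.

(** With s = h'(H_0(x)) the gradient is [s *: xi], where [H] equals |s| and has gradient sg(s) x /
    H_0(x). Since |s| sg(s) = s, the flux is linear in [h] although the operator is not linear. *)
Lemma finsler_flux_radial {n} (H : 'rV[R]_n -> R) (h : R -> R) (hH : finsler_norm H)
    (hball : strictly_convex_set [set xi | H xi < 1]) :
  flat_profile h ->
  finsler_flux H (h \o dual_norm H) = radial_field h (dual_norm H).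
Proof.
move=> ph; apply/funext => x; rewrite /finsler_flux.
have gH := gauge_dual_norm _ hH hball.
rewrite (grad_has_grad _ _ _ (has_grad_radial _ _ gH _ ph x)).
rewrite /radial_field; have [->|x0] := eqVneq x 0.
  by rewrite dual_norm0// (profile_derive0 _ ph) scale0r eqxx scaler0.
have := xgetPex 0 (ex_dual_at _ hH _ x0).
set xi := xget _ _ => xxi; set s := derive1 h _.
rewrite scaler_eq0 (negbTE (dual_at_neq0 _ hH _ _ xxi)) orbF.
(* At a critical point the conventional flux 0 agrees with the radial field. *)
have [->|s0] := eqVneq s 0; first by rewrite mul0r scale0r.
have d0 := dual_norm_gt0 _ hH _ x0.
have := grad_fnorm_dual_at _ hH s _ _ s0 x0 xxi.
rewrite -(dual_normE _ hH _ _ xxi) => E.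
rewrite (fnormZ hH) xxi.1 mulr1.
rewrite -[grad H _](scalerK (lt0r_neq0 d0)) E !scalerA.
by rewrite mulrAC [`|s| * _]mulrC -numEsg.
Qed.

Lemma finsler_laplacian_radial {n} (H : 'rV[R]_n -> R) (h : R -> R)
    (hH : finsler_norm H) (hball : strictly_convex_set [set xi | H xi < 1]) :
  flat_profile h ->
  finsler_laplacian_exists H (h \o dual_norm H) /\
  forall x, finsler_laplacian H (h \o dual_norm H) x =
    radial_laplacian (n := n) h (dual_norm H x).
Proof.
move=> ph; have gH := gauge_dual_norm _ hH hball.
rewrite /finsler_laplacian_exists /finsler_laplacian.
rewrite (finsler_flux_radial _ _ hH hball ph).
split=> [|x]; last exact: div_radial_field gH _ ph x.
split=> x; first by have [] := has_grad_radial _ _ gH _ ph x.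
exact: differentiable_radial_field gH _ ph x.
Qed.

End Profile.

Theorem theorem1p1 (R : realType) (N : nat) (hN : (1 <= N)%N)
    (H : 'rV[R]_N -> R) (hH : finsler_norm H)
    (hball : strictly_convex_set [set xi | H xi < 1])
    (v w : 'rV[R]_N -> R) (hv : C2_radial H v) (hw : C2_radial H w) :
  (finsler_laplacian_exists H v /\
   forall vs : R -> R, radial_profile H v vs ->
     forall x y : 'rV[R]_N, enorm y = dual_norm H x ->
       finsler_laplacian H v x = laplacian (euclidean_radial vs) y) /\
  (forall alpha beta : R,
     let u := fun x : 'rV[R]_N => alpha * v x + beta * w x in
     finsler_laplacian_exists H u /\
     forall x : 'rV[R]_N,
       finsler_laplacian H u x
       = alpha * finsler_laplacian H v x + beta * finsler_laplacian H w x).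
Proof.
(* A coordinate axis: it carries the profiles and supplies a nonzero vector. *)
pose i := Ordinal hN.
have profile u : C2_radial H u -> exists2 h, flat_profile h & u = h \o dual_norm H.
  move=> [us uE /(euclidean_radial_profile i)[h [ph hE]]]; exists h => //.
  by apply/funext => x; rewrite uE /= hE// dual_norm_ge0.
have [h ph vE] := profile _ hv.
have [k pk wE] := profile _ hw.
have [exv lapv] := finsler_laplacian_radial _ _ hH hball ph.
have [exw lapw] := finsler_laplacian_radial _ _ hH hball pk.
split.
  split=> [|vs vsE x y xy]; first by rewrite vE.
  rewrite vE lapv -xy -(laplacian_radial _ _ ph).
  (* [h] and [vs] are both profiles of [v], so they agree on the range of the dual norm, which
     contains every Euclidean norm. *)
  suff -> : h \o enorm = euclidean_radial vs :> ('rV[R]_N -> R) by [].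
  apply/funext => z; rewrite /euclidean_radial /=.
  have e0 : delta_mx 0 i != 0 :> 'rV[R]_N.
    by apply/eqP => /rowP/(_ i)/eqP; rewrite !mxE !eqxx oner_eq0.
  have [z' <-] := dual_norm_surj _ hH _ _ e0 (enorm_ge0 z).
  by rewrite -vsE vE.
move=> a b u; have [pu lapu] := profile_lincomb _ _ a b ph pk.
have -> : u = (fun t => a * h t + b * k t) \o dual_norm H.
  by apply/funext => x; rewrite /u vE wE.
have [exu lapE] := finsler_laplacian_radial _ _ hH hball pu.
by split=> // x; rewrite lapE vE wE lapv lapw lapu.
Qed.
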